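(* The following identity of formal power series holds: \[ \sum_{n \geq 0} h^*_{\Pi_{C_{n+1}}}(t)\, \frac{x^n}{n!} = e^{3x(t-1)}\, \operatorname{Eul}_A(t,2x)^2, \] where $\operatorname{Eul}_A(t,x) := \sum_{n\ge0} E_{A_n}(t)\frac{x^n}{n!} = \frac{t-1}{t - e^{x(t-1)}}$.
   Context: $E_{A_n}(t) := \sum_{w \in \mathfrak{S}_n} t^{\operatorname{des}(w)}$ is the classical Eulerian polynomial ($E_{A_0}(t)=1$), where $\operatorname{des}(w)$ is the number of $i$ with $w_i > w_{i+1}$. $\Pi_{C_n} := \{x \in \mathbb{R}^n \mid 0 \le 2x_1 \le 1,\ 0 \le x_i - x_{i-1} \le 1 \ (2 \le i \le n)\}$. For a polytope $P\subset\mathbb{R}^n$ of dimension $n$ with vertices in $\tfrac12\mathbb{Z}^n$, $L_P(r) := |rP \cap \tfrac12\mathbb{Z}^n|$ for $r\in\mathbb{Z}_{\ge0}$ and the $h^*$-polynomial $h^*_P(t)$ is defined by $\sum_{r\ge0}L_P(r)t^r = h^*_P(t)/(1-t)^{n+1}$. *)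

(* Defs.v *)
From HB Require Import structures.
From mathcomp Require Import all_boot all_order all_algebra all_fingroup.
From mathcomp Require Import finmap.
From mathcomp Require Import boolp classical_sets functions cardinality reals.

Set Implicit Arguments.
Unset Strict Implicit.
Unset Printing Implicit Defensive.

Import Order.TTheory GRing.Theory Num.Theory.
Local Open Scope classical_set_scope.
Local Open Scope ring_scope.

(* Formal power series, by their coefficients.  A record is used rather than
   nat -> A because function types already carry the pointwise product. *)
Record fps (A : Type) := FPS { fps_coef : nat -> A }.

HB.instance Definition _ (A : Type) := gen_eqMixin (fps A).
HB.instance Definition _ (A : Type) := gen_choiceMixin (fps A).

Lemma fpsP (A : Type) (f g : fps A) : fps_coef f =1 fps_coef g <-> f = g.
Proof.
split=> [|-> //]; case: f => f; case: g => g /= fg.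
by congr FPS; apply/funext.
Qed.

Section FpsRing.
Variable A : comNzRingType.
Implicit Types f g h : fps A.

Definition fps_add f g : fps A := FPS (fun n => fps_coef f n + fps_coef g n).
Definition fps_opp f : fps A := FPS (fun n => - fps_coef f n).
Definition fps_mul f g : fps A :=
  FPS (fun n => \sum_(i < n.+1) fps_coef f i * fps_coef g (n - i)%N).

Definition fps_of_poly (p : {poly A}) : fps A := FPS (fun n => p`_n).

Definition fps_const (a : A) : fps A := fps_of_poly a%:P.

Fact fps_addA : associative fps_add.
Proof. by move=> f g h; apply/fpsP=> n /=; rewrite addrA. Qed.
Fact fps_addC : commutative fps_add.
Proof. by move=> f g; apply/fpsP=> n /=; rewrite addrC. Qed.
Fact fps_add0 : left_id (fps_const 0) fps_add.
Proof. by move=> f; apply/fpsP=> n /=; rewrite coef0 add0r. Qed.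
Fact fps_addN : left_inverse (fps_const 0) fps_opp fps_add.
Proof. by move=> f; apply/fpsP=> n /=; rewrite coef0 addNr. Qed.

HB.instance Definition _ :=
  GRing.isZmodule.Build (fps A) fps_addA fps_addC fps_add0 fps_addN.

Let trunc N f : {poly A} := \poly_(i < N) fps_coef f i.

Let coef_trunc N f n : (n < N)%N -> (trunc N f)`_n = fps_coef f n.
Proof. by move=> ltnN; rewrite coef_poly ltnN. Qed.

Let coefM_low (p q p' q' : {poly A}) n :
    (forall i, (i <= n)%N -> p`_i = p'`_i) ->
    (forall i, (i <= n)%N -> q`_i = q'`_i) ->
  (p * q)`_n = (p' * q')`_n.
Proof.
move=> pp qq; rewrite !coefM; apply: eq_bigr => i _.
by rewrite pp ?qq ?leq_subr // -ltnS.
Qed.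

Let fps_mul_trunc N f g n :
  (n < N)%N -> fps_coef (fps_mul f g) n = (trunc N f * trunc N g)`_n.
Proof.
move=> ltnN; rewrite coefM; apply: eq_bigr => i _.
rewrite !coef_trunc //; first by rewrite (leq_ltn_trans (leq_subr _ _)).
by rewrite (leq_trans (ltn_ord i)).
Qed.

Fact fps_mulC : commutative fps_mul.
Proof.
move=> f g; apply/fpsP=> n.
by rewrite !(@fps_mul_trunc n.+1) // mulrC.
Qed.

Fact fps_mulA : associative fps_mul.
Proof.
move=> f g h; apply/fpsP=> n; rewrite !(@fps_mul_trunc n.+1) //.
have low u v i : (i <= n)%N ->
    (trunc n.+1 (fps_mul u v))`_i = (trunc n.+1 u * trunc n.+1 v)`_i.
  by move=> lein; rewrite coef_trunc // (@fps_mul_trunc n.+1).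
rewrite (@coefM_low _ _ (trunc n.+1 f) (trunc n.+1 g * trunc n.+1 h)) //.
  by rewrite mulrA; apply: coefM_low => // i lein; rewrite low.
by move=> i lein; rewrite low.
Qed.

Fact fps_mul1 : left_id (fps_const 1) fps_mul.
Proof.
move=> f; apply/fpsP=> n /=; rewrite big_ord_recl coef1 mul1r subn0.
by rewrite big1 ?addr0 // => i _; rewrite coef1 mul0r.
Qed.

Fact fps_mulDl : left_distributive fps_mul fps_add.
Proof.
move=> f g h; apply/fpsP=> n /=; rewrite -big_split /=.
by apply: eq_bigr => i _; rewrite mulrDl.
Qed.

Fact fps_one_neq0 : fps_const 1 != 0 :> fps A.
Proof.
apply/eqP => /fpsP /(_ 0) /=; rewrite coef1 coef0.
exact/eqP/oner_neq0.
Qed.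

HB.instance Definition _ := GRing.Zmodule_isComNzRing.Build (fps A)
  fps_mulA fps_mulC fps_mul1 fps_mulDl fps_one_neq0.

(* f(x) |-> f(c x) *)
Definition fps_dilate (c : A) (f : fps A) : fps A :=
  FPS (fun n => c ^+ n * fps_coef f n).

End FpsRing.

(* Series in x with coefficients in Q[t]; t is 'X : {poly rat}. *)

Definition egf (a : nat -> {poly rat}) : fps {poly rat} :=
  FPS (fun n => (n`!%:R)^-1 *: a n).

(* e^(c x) *)
Definition fps_exp (c : {poly rat}) : fps {poly rat} :=
  fps_dilate c (egf (fun=> 1)).

Definition des (n : nat) (w : 'S_n) : nat :=
  #|[pred p : 'I_n * 'I_n | (p.2 == p.1.+1 :> nat) && (w p.2 < w p.1)%N]|.

Definition eulerianA (n : nat) : {poly rat} := \sum_(w : 'S_n) 'X^(des w).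

Definition EulA : fps {poly rat} := egf eulerianA.

Section Ehrhart.
Variable R : realType.

Definition half_lattice (n : nat) : set 'rV[R]_n :=
  [set x : 'rV[R]_n | forall i, exists z : int, x 0 i = z%:~R / 2].

Arguments half_lattice n : clear implicits.

Definition dilate (n r : nat) (P : set 'rV[R]_n) : set 'rV[R]_n :=
  [set r%:R *: x | x in P].

(* fset_set returns the empty set on infinite sets; for bounded P the
   intersection is finite. *)
Definition ehrhart (n : nat) (P : set 'rV[R]_n) (r : nat) : nat :=
  #|` fset_set (dilate r P `&` half_lattice n)|%fset.

Definition ehrhart_series (n : nat) (P : set 'rV[R]_n) : fps rat :=
  FPS (fun r => (ehrhart P r)%:R).

Definition is_hstar (n : nat) (P : set 'rV[R]_n) (h : {poly rat}) : Prop :=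
  (1 - fps_of_poly 'X) ^+ n.+1 * ehrhart_series P = fps_of_poly h.

Lemma is_hstar_unique (n : nat) (P : set 'rV[R]_n) (h h' : {poly rat}) :
  is_hstar P h -> is_hstar P h' -> h = h'.
Proof. by rewrite /is_hstar => -> /fpsP hh; apply/polyP. Qed.

(* For P of full dimension n; the default 0 is never the h^*-polynomial of a
   nonempty bounded P, as its constant coefficient is then L_P(0) = 1. *)
Definition hstar (n : nat) (P : set 'rV[R]_n) : {poly rat} :=
  xget 0 [set h | is_hstar P h].

Lemma hstarE (n : nat) (P : set 'rV[R]_n) (h : {poly rat}) :
  is_hstar P h -> hstar P = h.
Proof.
by move=> Ph; apply: xget_unique => // h' Ph'; apply: is_hstar_unique Ph' Ph.
Qed.

(* Coordinates are numbered from 0. *)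
Definition PiC (n : nat) : set 'rV[R]_n :=
  [set x : 'rV[R]_n |
     (forall i : 'I_n, i = 0 :> nat -> 0 <= 2 * x 0 i <= 1) /\
     (forall i j : 'I_n, j = i.+1 :> nat -> 0 <= x 0 j - x 0 i <= 1)].

End Ehrhart.

Arguments half_lattice R n : clear implicits.
Arguments PiC R n : clear implicits.

(* Main.v *)
(* Half-lattice points of r Pi_{C_(n+1)} are determined by 2 x_1 in [0, r] and
   the differences 2 (x_i - x_(i-1)) in [0, 2r], so the Ehrhart function is
   (r + 1) (2 r + 1)^n and the left-hand side is
   (1 - t)^2 sum_r (r + 1) t^r e^((1 - t) (2 r + 1) x).
   Inserting the largest letter gives
   E_(n+1) = (1 + n t) E_n + t (1 - t) E_n', hence
   E_n = (1 - t)^(n+1) sum_r (r + 1)^n t^r, i.e.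
   Eul_A(t, x) = (1 - t) sum_r t^r e^((1 - t) (r + 1) x).
   Squaring Eul_A(t, 2 x) gives exponents 2 r + 4 with multiplicity r + 1, and
   e^(3 x (t - 1)) shifts them to 2 r + 1; likewise e^(x (t - 1)) Eul_A(t, x)
   has exponents r instead of r + 1, which is the closed form of Eul_A. *)
Require Import Defs.
From HB Require Import structures.
From mathcomp Require Import all_boot all_order all_algebra all_fingroup.
From mathcomp Require Import finmap.
From mathcomp Require Import boolp classical_sets functions cardinality reals.
From mathcomp Require Import zify ring lra.

Set Implicit Arguments.
Unset Strict Implicit.
Unset Printing Implicit Defensive.

Import Order.TTheory GRing.Theory Num.Theory.
Local Open Scope classical_set_scope.
Local Open Scope ring_scope.

(** * Descents under insertion of the largest letter *)

(** The word occupies positions 0 to [m]. Indexing by [nat] lets a letter be inserted without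
    changing types. *)
Definition descents (m : nat) (f : nat -> nat) : nat :=
  \sum_(0 <= k < m) (f k.+1 < f k)%N.

Lemma des_descents (m : nat) (w : 'S_m.+1) :
  des w = descents m (fun k => w (inord k)).
Proof.
rewrite /des /descents -sum1_card big_mkcond /=.
rewrite -(pair_bigA _ (fun i j : 'I_m.+1 =>
  if (j == i.+1 :> nat) && (w j < w i)%N then 1%N else 0%N)) /=.
(* The row of the last position is empty, since it has no successor. *)
rewrite big_ord_recr /= [X in (_ + X)%N]big1 ?addn0; last first.
  by move=> j _; rewrite ltn_eqF ?ltn_ord.
rewrite big_mkord; apply: eq_bigr => k _.
have kS : (inord k.+1 : 'I_m.+1) = k.+1 :> nat by rewrite inordK // ltnS ltn_ord.
rewrite (bigD1 (inord k.+1)) //= big1 ?addn0; last first.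
  move=> j jk; case: eqP => //= jE; case/eqP: jk; apply/val_inj.
  by rewrite /= kS jE.
rewrite kS eqxx /=.
have -> : widen_ord (leqnSn m) k = inord k.
  by apply/val_inj; rewrite /= inordK // ltnW // ltnS.
by case: ifP.
Qed.

Definition insert_at (i M : nat) (f : nat -> nat) (k : nat) : nat :=
  if (k < i)%N then f k else if k == i then M else f k.-1.

Lemma descents_insert_first (m M : nat) (f : nat -> nat) :
  (f 0 < M)%N -> descents m.+1 (insert_at 0 M f) = (descents m f).+1.
Proof.
move=> fM; rewrite /descents big_nat_recl //= /insert_at /= fM add1n.
by congr S; apply: eq_big_nat => k _.
Qed.

Lemma descents_insert_last (m M : nat) (f : nat -> nat) :
  (f m < M)%N -> descents m.+1 (insert_at m.+1 M f) = descents m f.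
Proof.
move=> fM; rewrite /descents big_nat_recr //= /insert_at ltnn eqxx ltnS leqnn.
rewrite [(M < _)%N]ltnNge (ltnW fM) addn0; apply: eq_big_nat => k /andP[_ km].
by rewrite !ltnS km (ltnW km).
Qed.

(** The step up into [M] is never a descent and the step down from it always is. So the gap counts
    exactly once after insertion, whatever it counted before. *)
Lemma descents_insert_gap (j m M : nat) (f : nat -> nat) : (j < m)%N ->
  (forall k, (k <= m)%N -> (f k < M)%N) ->
  descents m.+1 (insert_at j.+1 M f) = (descents m f + ~~ (f j.+1 < f j))%N.
Proof.
move=> jm fM; set g := insert_at j.+1 M f.
have g_lt k : (k <= j)%N -> g k = f k by rewrite /g /insert_at ltnS => ->.
have g_eq : g j.+1 = M by rewrite /g /insert_at ltnn eqxx.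
have g_gt k : (j < k)%N -> g k.+1 = f k.
  by move=> jk; rewrite /g /insert_at !ltnS ltnNge (ltnW jk) eqSS gtn_eqF.
rewrite /descents (@big_cat_nat _ _ _ j.+2) //= big_nat_recr //= big_nat_recr //=.
rewrite (@big_cat_nat _ _ _ j.+1 0 m) //= [in RHS]big_nat_recr //=.
rewrite g_eq g_gt // (g_lt j) // fM // [(M < f j)%N]ltnNge (ltnW (fM _ (ltnW jm))).
have -> : (\sum_(0 <= k < j) (g k.+1 < g k) = \sum_(0 <= k < j) (f k.+1 < f k))%N.
  by apply: eq_big_nat => k /andP[_ kj]; rewrite !g_lt // ltnW.
have -> : (\sum_(j.+2 <= k < m.+1) (g k.+1 < g k) =
           \sum_(j.+1 <= k < m) (f k.+1 < f k))%N.
  rewrite big_add1 /=; apply: eq_big_nat => k /andP[jk _].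
  by rewrite !g_gt // ltnW.
by case: (f j.+1 < f j)%N; lia.
Qed.

Lemma lift_perm_insert (m : nat) (i : 'I_m.+2) (s : 'S_m.+1) (k : nat) :
  (k <= m.+1)%N ->
  lift_perm i ord_max s (inord k) =
    insert_at i m.+1 (fun k => s (inord k)) k :> nat.
Proof.
move=> km; have kK : (inord k : 'I_m.+2) = k :> nat by rewrite inordK.
rewrite /insert_at; case: (ltngtP k i) => ki.
- have -> : inord k = lift i (inord k : 'I_m.+1).
    apply/val_inj; rewrite /= kK inordK /bump; last by have := ltn_ord i; lia.
    by rewrite leqNgt ki.
  by rewrite lift_perm_lift lift_max.
- have -> : inord k = lift i (inord k.-1 : 'I_m.+1).
    apply/val_inj; rewrite /= kK inordK /bump; lia.
  by rewrite lift_perm_lift lift_max.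
- have -> : inord k = i by apply/val_inj; rewrite /= kK.
  by rewrite lift_perm_id.
Qed.

Lemma des_lift_perm (m : nat) (i : 'I_m.+2) (s : 'S_m.+1) :
  des (lift_perm i ord_max s) =
    descents m.+1 (insert_at i m.+1 (fun k => s (inord k))).
Proof.
rewrite des_descents; apply: eq_big_nat => k /andP[_ km].
by rewrite !lift_perm_insert // ltnW.
Qed.

(** The last slot and the [des s] descent gaps keep the number of descents; the first slot and the
    [m - des s] other gaps raise it by one. *)
Lemma sum_des_lift_perm (m : nat) (s : 'S_m.+1) :
  \sum_(i < m.+2) 'X^(des (lift_perm i ord_max s)) =
  (des s).+1%:R * 'X^(des s)
    + (m.+1%:R - (des s)%:R) * 'X^((des s).+1) :> {poly rat}.
Proof.
have sM k : (s (inord k) < m.+1)%N by exact: ltn_ord.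
rewrite big_ord_recl big_ord_recr /= !des_lift_perm /=.
rewrite descents_insert_first // -des_descents.
rewrite descents_insert_last // -des_descents.
set d := des s.
have -> : \sum_(j < m) 'X^(des (lift_perm (lift ord0 (widen_ord (leqnSn m) j))
      ord_max s)) = d%:R * 'X^d + (m%:R - d%:R) * 'X^(d.+1) :> {poly rat}.
  under eq_bigr => j _.
    rewrite des_lift_perm /= /bump leq0n add1n.
    rewrite descents_insert_gap // -des_descents -/d.
    (* Affine in the descent indicator, so that the sum over the gaps only counts descents. *)
    have -> : 'X^(d + ~~ (s (inord j.+1) < s (inord j)))%N =
      (s (inord j.+1) < s (inord j))%N%:R * ('X^d - 'X^(d.+1)) + 'X^(d.+1)
        :> {poly rat}.
      by case: ltnP => _; rewrite /= ?addn0 ?addn1; ring.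
    over.
  rewrite big_split /= -mulr_suml -natr_sum.
  rewrite -(big_mkord predT (fun j => nat_of_bool (s (inord j.+1) < s (inord j))%N)).
  rewrite -/(descents m (fun k => s (inord k))) -des_descents -/d.
  by rewrite sumr_const card_ord; ring.
by rewrite -!natr1; ring.
Qed.

(** By cardinality, injectivity is enough: [i] is recovered as the place of the largest letter. *)
Lemma lift_perm_bij (n : nat) :
  bijective (fun p : 'I_n.+1 * 'S_n => lift_perm p.1 ord_max p.2).
Proof.
apply: inj_card_bij => [[i s] [j u] /= eq_su|]; last first.
  by rewrite card_prod card_ord !card_Sn factS.
have ij : i = j.
  by apply: (@perm_inj _ (lift_perm i ord_max s)); rewrite {2}eq_su !lift_perm_id.
move: eq_su; rewrite -ij => eq_su; congr pair; apply/permP=> k.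
by apply: (@lift_inj _ ord_max); rewrite -!(lift_perm_lift i) eq_su.
Qed.

Lemma eulerianA0 : eulerianA 0 = 1.
Proof.
rewrite /eulerianA (big_pred1 1%g) => [|s]; last first.
  by apply/esym/eqP/permP=> -[].
by rewrite /des eq_card0 // => -[[]].
Qed.

(** A permutation with d descents contributes (d + 1) t^d + (n - d) t^(d+1) = (1 + n t) t^d + (1 -
    t) d t^d, and t d/dt produces the factor d. *)
Lemma eulerianAS (n : nat) :
  eulerianA n.+1 =
    (1 + n%:R * 'X) * eulerianA n + (1 - 'X) * ('X * (eulerianA n)^`()).
Proof.
case: n => [|m].
  rewrite eulerianA0 /eulerianA (big_pred1 1%g) => [|s]; last first.
    by apply/esym/eqP/permP=> i; rewrite !ord1.
  rewrite des_descents /descents big_nil derivC; ring.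
rewrite {1}/eulerianA (reindex _ (onW_bij _ (@lift_perm_bij m.+1))) /=.
rewrite -(pair_bigA _ (fun i s => 'X^(des (lift_perm i ord_max s)))) /=.
rewrite exchange_big /= (eq_bigr _ (fun s _ => sum_des_lift_perm s)).
rewrite /eulerianA raddf_sum !mulr_sumr -big_split /=; apply: eq_bigr => s _.
rewrite derivXn; set d := des s.
have -> : 'X * ('X^(d.-1) *+ d) = d%:R * 'X^d :> {poly rat}.
  by case: d => [|d]; rewrite ?mulr0 ?mul0r // mulrnAr -exprS mulr_natl.
rewrite -(natr1 d) exprS; ring.
Qed.

(** * Formal power series and the derivation t d/dt *)

Section FpsTheory.
Variable A : comNzRingType.
Implicit Types f g : fps A.

Lemma coef_fpsD f g n : fps_coef (f + g) n = fps_coef f n + fps_coef g n.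
Proof. by []. Qed.

Lemma coef_fpsN f n : fps_coef (- f) n = - fps_coef f n.
Proof. by []. Qed.

Lemma coef_fpsM f g n :
  fps_coef (f * g) n = \sum_(i < n.+1) fps_coef f i * fps_coef g (n - i)%N.
Proof. by []. Qed.

Lemma coef_fps0 n : fps_coef (0 : fps A) n = 0.
Proof. exact: coef0. Qed.

Lemma coef_fps_sum (I : Type) (r : seq I) (P : pred I) (F : I -> fps A) n :
  fps_coef (\sum_(i <- r | P i) F i) n = \sum_(i <- r | P i) fps_coef (F i) n.
Proof.
by apply: (big_morph (fun f => fps_coef f n)) => //; exact: coef_fps0.
Qed.

Lemma coef_fpsMn f k n : fps_coef (f *+ k) n = fps_coef f n *+ k.
Proof.
by elim: k => [|k IHk]; rewrite ?mulr0n ?coef_fps0 // !mulrSr coef_fpsD IHk.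
Qed.

Lemma fps_of_poly_is_zmod_morphism : zmod_morphism (@fps_of_poly A).
Proof. by move=> p q; apply/fpsP=> n /=; rewrite coefB. Qed.

Lemma fps_of_poly_is_monoid_morphism : monoid_morphism (@fps_of_poly A).
Proof. by split=> // p q; apply/fpsP=> n /=; rewrite coefM. Qed.

HB.instance Definition _ := GRing.isZmodMorphism.Build {poly A} (fps A)
  (@fps_of_poly A) fps_of_poly_is_zmod_morphism.
HB.instance Definition _ := GRing.isMonoidMorphism.Build {poly A} (fps A)
  (@fps_of_poly A) fps_of_poly_is_monoid_morphism.

Lemma fps_of_poly_inj : injective (@fps_of_poly A).
Proof. by move=> p q /fpsP pq; apply/polyP. Qed.

Lemma coef_fpsCM (a : A) f n :
  fps_coef (fps_of_poly a%:P * f) n = a * fps_coef f n.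
Proof.
rewrite coef_fpsM big_ord_recl /= coefC eqxx subn0 big1 ?addr0 // => i _.
by rewrite coefC mul0r.
Qed.

Lemma coef_fpsXM f n :
  fps_coef (fps_of_poly 'X * f) n = if n is m.+1 then fps_coef f m else 0.
Proof.
rewrite coef_fpsM big_ord_recl /= coefX mul0r add0r.
case: n => [|n]; first by rewrite big_ord0.
rewrite big_ord_recl /= coefX mul1r subSS subn0 big1 ?addr0 // => i _.
by rewrite coefX mul0r.
Qed.

(* t d/dt *)
Definition fps_theta f : fps A := FPS (fun n => n%:R * fps_coef f n).

Lemma fps_thetaM f g : fps_theta (f * g) = fps_theta f * g + f * fps_theta g.
Proof.
apply/fpsP=> n; rewrite coef_fpsD !coef_fpsM -big_split /= mulr_sumr.
apply: eq_bigr => i _.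
have -> : n%:R = i%:R + (n - i)%:R :> A by rewrite -natrD subnKC // -ltnS.
ring.
Qed.

Lemma fps_theta_poly (p : {poly A}) :
  fps_theta (fps_of_poly p) = fps_of_poly ('X * p^`()).
Proof.
apply/fpsP=> -[|n] /=; rewrite coefXM ?mul0r //=.
by rewrite coef_deriv mulr_natl.
Qed.

End FpsTheory.

(** * Exponential generating functions and moment numerators *)

Lemma egfM (a b : nat -> {poly rat}) :
  egf a * egf b =
    egf (fun n => \sum_(i < n.+1) (a i * b (n - i)%N) *+ 'C(n, i)).
Proof.
apply/fpsP=> n; rewrite coef_fpsM /= scaler_sumr; apply: eq_bigr => i _.
rewrite -scalerAl -scalerAr scalerA -scaler_nat scalerA; congr (_ *: _).
have nz k : k`!%:R != 0 :> rat by rewrite pnatr_eq0 -lt0n fact_gt0.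
have := bin_fact (ltn_ord i : (i <= n)%N) => <-; rewrite !natrM.
have : 'C(n, i)%:R != 0 :> rat by rewrite pnatr_eq0 -lt0n bin_gt0 -ltnS.
by move=> bnz; field; rewrite bnz !nz.
Qed.

Lemma fps_dilate_egf (c : {poly rat}) (a : nat -> {poly rat}) :
  fps_dilate c (egf a) = egf (fun n => c ^+ n * a n).
Proof. by apply/fpsP=> n /=; rewrite scalerAr. Qed.

Definition moments (w l : nat -> rat) (n : nat) : fps rat :=
  FPS (fun r => w r * l r ^+ n).

(* The exponential generating function of [h] is then
   (1 - t)^d sum_r w(r) t^r e^((1 - t) l(r) x), which makes products of such
   functions with each other and with e^(c x (t - 1)) explicit. *)
Definition moment_numerators (d : nat) (w l : nat -> rat)
    (h : nat -> {poly rat}) : Prop :=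
  forall n, fps_of_poly (h n) =
    fps_of_poly (1 - 'X) ^+ (d + n)%N * moments w l n.

Lemma eq_moment_numerators d (w l w' l' : nat -> rat) (h h' : nat -> {poly rat}) :
  w =1 w' -> l =1 l' -> h =1 h' ->
  moment_numerators d w l h -> moment_numerators d w' l' h'.
Proof. by move=> /funext <- /funext <- /funext <-. Qed.

(** Let M be the series of (r + 1)^n t^r; the next one is M + t M'. In the recurrence, t d/dt of (1
    - t)^(n+1) gives -(n + 1) t (1 - t)^n, which turns the coefficient 1 + n t of M into 1 - t, the
    same as that of t M'. *)
Lemma eulerianA_moments :
  moment_numerators 1 (fun=> 1) (fun r => r.+1%:R) eulerianA.
Proof.
elim=> [|n IHn].
  rewrite eulerianA0 expr1 rmorphB !rmorph1 mulrBl mul1r.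
  apply/fpsP=> -[|n]; rewrite coef_fpsD coef_fpsN coef_fpsXM /= coef1 ?mul1r.
    by rewrite subr0.
  by rewrite subrr.
rewrite eulerianAS rmorphD rmorphM (rmorphM _ (1 - 'X)) /=.
rewrite -fps_theta_poly IHn.
rewrite fps_thetaM -rmorphXn fps_theta_poly deriv_exp /=.
have -> : moments (fun=> 1) (fun r => r.+1%:R) n.+1 =
    moments (fun=> 1) (fun r => r.+1%:R) n +
    fps_theta (moments (fun=> 1) (fun r => r.+1%:R) n).
  by apply/fpsP=> r /=; rewrite exprS -natr1; ring.
set M := moments _ _ n; set T := fps_theta M.
rewrite derivB derivX derivC sub0r mulN1r.
rewrite !(rmorphM, rmorphD, rmorphN, rmorphXn, rmorphMn, rmorph1, rmorph_nat) /=.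
rewrite !add1n add0n -[_ *+ n.+1]mulr_natr -natr1 !exprS.

ring.
Qed.

Lemma moment_numerators_dilate d w l h (c : rat) :
  moment_numerators d w l h ->
  moment_numerators d w (fun r => c * l r) (fun n => c%:P ^+ n * h n).
Proof.
move=> hM n; rewrite rmorphM /= hM /= -rmorphXn mulrCA; congr (_ * _).
by apply/fpsP=> r; rewrite coef_fpsCM /= exprMn mulrCA.
Qed.

(** The new numerators are those of e^(c x (t - 1)) times the generating function of [h]. As c (t -
    1) = (- c) (1 - t), each such factor supplies a missing power of 1 - t, and the binomial theorem
    yields (l(r) - c)^n. *)
Lemma moment_numerators_exp d w l h (c : rat) :
  moment_numerators d w l h ->
  moment_numerators d w (fun r => l r - c) (fun n =>
    \sum_(i < n.+1) ((c%:P * ('X - 1)) ^+ i * h (n - i)%N) *+ 'C(n, i)).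
Proof.
move=> hM n; rewrite rmorph_sum /=.
transitivity (fps_of_poly (1 - 'X) ^+ (d + n) * \sum_(i < n.+1)
    (fps_of_poly ((- c) ^+ i)%:P * moments w l (n - i)) *+ 'C(n, i)).
  rewrite mulr_sumr; apply: eq_bigr => i _.
  rewrite rmorphMn rmorphM /= hM /= mulrnAr; congr (_ *+ _).
  have -> : c%:P * ('X - 1) = (- c)%:P * (1 - 'X) by rewrite polyCN; ring.
  have -> : (d + n = i + (d + (n - i)))%N by have := ltn_ord i; lia.
  rewrite exprMn (exprD _ i) polyC_exp !(rmorphM, rmorphXn) /=; ring.
congr (_ * _); apply/fpsP=> r; rewrite coef_fps_sum /= exprDn mulr_sumr.
apply: eq_bigr => i _; rewrite coef_fpsMn coef_fpsCM /= mulrnAr.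
by congr (_ *+ _); ring.
Qed.

(** With a common slope [a], the nodes at j and r - j add up to a r + b + b' independently of j, so
    the convolution in t has r + 1 equal terms. *)
Lemma moment_numerators_mul d d' (a b b' : rat) h h' :
  moment_numerators d (fun=> 1) (fun r => a * r%:R + b) h ->
  moment_numerators d' (fun=> 1) (fun r => a * r%:R + b') h' ->
  moment_numerators (d + d') (fun r => r.+1%:R)
    (fun r => a * r%:R + (b + b'))
    (fun n => \sum_(i < n.+1) (h i * h' (n - i)%N) *+ 'C(n, i)).
Proof.
move=> hM hM' n; rewrite rmorph_sum /=.
pose P := moments (fun=> 1) (fun r => a * r%:R + b).
pose P' := moments (fun=> 1) (fun r => a * r%:R + b').
transitivity (fps_of_poly (1 - 'X) ^+ (d + d' + n) * \sum_(i < n.+1)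
    (P i * P' (n - i)%N) *+ 'C(n, i)).
  rewrite mulr_sumr; apply: eq_bigr => i _.
  rewrite rmorphMn rmorphM /= hM hM' /= mulrACA -exprD mulrnAr; congr (_ ^+ _ * _ *+ _).
  by have := ltn_ord i; lia.
congr (_ * _); apply/fpsP=> r; rewrite coef_fps_sum /=.
transitivity (\sum_(j < r.+1) (a * r%:R + (b + b')) ^+ n); last first.
  by rewrite sumr_const card_ord mulr_natl.
under eq_bigr => i _ do rewrite coef_fpsMn coef_fpsM -sumrMnl.
rewrite exchange_big; apply: eq_bigr => j _ /=.
have -> : a * r%:R + (b + b') = (a * (r - j)%:R + b') + (a * j%:R + b).
  by rewrite natrB -1?ltnS //; ring.
rewrite exprDn; apply: eq_bigr => i _; congr (_ *+ _); ring.
Qed.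

Lemma fps_exp_egf (c : {poly rat}) : fps_exp c = egf (fun n => c ^+ n).
Proof. by rewrite /fps_exp fps_dilate_egf; apply/fpsP=> n /=; rewrite mulr1. Qed.

(** * Counting half-lattice points of the dilated polytope *)

Lemma card_fset_set_range (T : finType) (U : choiceType) (f : T -> U) :
  injective f -> #|` fset_set (range f)|%fset = #|T|.
Proof.
move=> f_inj; apply: card_fset_set.
have fT : (range f #= [set: T])%card by apply: inj_card_eq => x y _ _ /f_inj.
have eT : (range (@enum_rank T) #= [set: T])%card.
  by apply: inj_card_eq => x y _ _ /enum_rank_inj.
have eI : range (@enum_rank T) = [set: 'I_#|T|].
  by apply/seteqP; split=> // i _; exists (enum_val i); rewrite ?enum_valK.
rewrite eI card_eq_sym in eT.
apply: card_eq_trans fT (card_eq_trans eT _).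
by rewrite card_eq_sym card_II.
Qed.

Section EhrhartPiC.
Variable R : realType.

Lemma dilate_PiC (n r : nat) :
  dilate r (PiC R n) = [set x : 'rV[R]_n |
    (forall i : 'I_n, i = 0 :> nat -> 0 <= 2 * x 0 i <= r%:R) /\
    (forall i j : 'I_n, j = i.+1 :> nat -> 0 <= x 0 j - x 0 i <= r%:R)].
Proof.
apply/seteqP; split=> [_ [x [x0 xd] <-] | x [x0 xd]].
  split=> [i /x0 | i j /xd]; rewrite !mxE => /andP[ge0 le1].
    by rewrite mulrCA mulr_ge0 // ler_piMr.
  by rewrite -mulrBr mulr_ge0 // ler_piMr.
(* For r = 0 one cannot divide by r; there the inequalities force each coordinate of [x] in turn to
   be 0. *)
case: r x0 xd => [|r] x0 xd.
  exists 0; first by split=> *; rewrite !mxE ?mulr0 ?subrr lexx ler01.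
  rewrite scale0r; apply/rowP=> -[i lti]; rewrite mxE.
  elim: i lti => [|i IHi] lti; first by have := x0 (Ordinal lti) erefl; lra.
  have := xd (Ordinal (ltnW lti)) (Ordinal lti) erefl.
  by rewrite -IHi; lra.
have rgt0 : 0 < r.+1%:R :> R by rewrite ltr0n.
exists (r.+1%:R^-1 *: x); last by rewrite scalerA divff ?scale1r // gt_eqF.
split=> [i /x0 | i j /xd] /andP[ge0 ler]; rewrite !mxE.
  by rewrite mulrCA mulr_ge0 ?invr_ge0 ?(ltW rgt0) // mulrC ler_pdivrMr ?mul1r.
rewrite -mulrBr mulr_ge0 ?invr_ge0 ?(ltW rgt0) //.
by rewrite mulrC ler_pdivrMr ?mul1r.
Qed.

(* The coordinates [2 x_0 = a] and [2 (x_(i+1) - x_i) = d i] turn the dilated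
   polytope into a box. *)
Definition steps_point (n r : nat) (p : 'I_r.+1 * {ffun 'I_n -> 'I_r.*2.+1}) :
    'rV[R]_n.+1 :=
  \row_i ((p.1 + \sum_(j < n | (j < i)%N) p.2 j)%N%:R / 2).

Lemma sum_below_recr (n : nat) (f : 'I_n -> nat) (i : 'I_n) :
  (\sum_(j < n | (j < i.+1)%N) f j = \sum_(j < n | (j < i)%N) f j + f i)%N.
Proof.
rewrite (bigD1 i) //= addnC; congr (_ + _)%N; apply: eq_bigl => j.
by rewrite ltnS ltn_neqAle andbC.
Qed.

Lemma steps_point0 (n r : nat) (p : 'I_r.+1 * {ffun 'I_n -> 'I_r.*2.+1})
    (i : 'I_n.+1) :
  i = 0 :> nat -> 2 * steps_point p 0 i = (p.1)%:R.
Proof.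
by move=> i0; rewrite mxE i0 big_pred0 // addn0 mulrC divfK ?pnatr_eq0.
Qed.

Lemma steps_point_step (n r : nat) (p : 'I_r.+1 * {ffun 'I_n -> 'I_r.*2.+1})
    (k : 'I_n) (i j : 'I_n.+1) : i = k :> nat -> j = k.+1 :> nat ->
  steps_point p 0 j - steps_point p 0 i = (p.2 k)%:R / 2.
Proof.
by move=> ik jk; rewrite !mxE ik jk sum_below_recr addnA natrD; field.
Qed.

Lemma steps_point_inj (n r : nat) : injective (@steps_point n r).
Proof.
move=> p q pq; have nat_inj (a b : nat) : a%:R = b%:R :> R -> a = b.
  by move/eqP; rewrite eqr_nat => /eqP.
have e1 : p.1 = q.1.
  by apply/val_inj/nat_inj; rewrite -!(@steps_point0 _ _ _ ord0) // pq.
have e2 : p.2 = q.2.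
  apply/ffunP=> k; apply/val_inj/nat_inj.
  have stepE (s : 'I_r.+1 * {ffun 'I_n -> 'I_r.*2.+1}) :
      (s.2 k)%:R = 2 * (steps_point s 0 (lift ord0 k)
                        - steps_point s 0 (widen_ord (leqnSn n) k)).
    by rewrite (@steps_point_step _ _ _ k) //=; field.
  by rewrite !stepE pq.
by rewrite (surjective_pairing p) (surjective_pairing q) e1 e2.
Qed.

(** Write x = z / 2 with z integral. The first condition bounds 2 x_0 = z_0 by r, while the others
    bound half of a difference of z, hence the range up to 2 r. *)
Lemma dilate_PiC_half_lattice (n r : nat) :
  dilate r (PiC R n.+1) `&` half_lattice R n.+1 = range (@steps_point n r).
Proof.
rewrite dilate_PiC; apply/seteqP; split=> [x [[x0 xd] /choice[z xz]] | _ [p _ <-]].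
  have widenS (k : 'I_n) : lift ord0 k = (widen_ord (leqnSn n) k).+1 :> nat by [].
  have z0 : 0 <= z ord0 <= r%:Z.
    by have := x0 ord0 erefl; rewrite xz mulrC divfK ?pnatr_eq0 // ler0z (ler_int R _ r%:Z).
  pose dz k := z (lift ord0 k) - z (widen_ord (leqnSn n) k).
  have zd k : 0 <= dz k <= r.*2%:Z.
    have := xd _ _ (widenS k); rewrite !xz -mulrBl -intrB.
    rewrite -(ler0z R) -(ler_int R) -muln2 -[(_ * 2)%:Z%:~R]pmulrn natrM -/(dz k); lra.
  (* The bounds [z0] and [zd] ensure that neither the absolute values nor [inord] alter these
     integers. *)
  pose p : 'I_r.+1 * {ffun 'I_n -> 'I_r.*2.+1} :=
    (inord `|z ord0|%N, [ffun k => inord `|dz k|%N]).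
  exists p => //; apply/rowP=> -[i]; elim: i => [|i IHi] lti.
    have -> : Ordinal lti = ord0 by apply/val_inj.
    have : 2 * steps_point p 0 ord0 = 2 * x 0 ord0; last by lra.
    rewrite steps_point0 // xz mulrC divfK ?pnatr_eq0 //= inordK; last lia.
    by rewrite pmulrn gez0_abs //; case/andP: z0.
  pose k := Ordinal (lti : (i < n)%N).
  have := @steps_point_step n r p k (Ordinal (ltnW lti)) (Ordinal lti) erefl erefl.
  have <- : lift ord0 k = Ordinal lti by apply/val_inj.
  have ik : widen_ord (leqnSn n) k = Ordinal (ltnW lti) by apply/val_inj.
  have := zd k; rewrite IHi -ik /= ffunE => zdk; rewrite inordK; last lia.
  have -> : `|dz k|%:R = (dz k)%:~R :> R.
    by rewrite pmulrn gez0_abs //; case/andP: zdk.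
  by rewrite /dz intrB !xz; lra.
split; last first.
  by move=> i; exists (p.1 + \sum_(j < n | (j < i)%N) p.2 j)%N%:Z; rewrite mxE.
split=> [i i0 | i j ij].
  by rewrite steps_point0 // ler0n ler_nat -ltnS ltn_ord.
have lti : (i < n)%N by rewrite -ltnS -ij.
rewrite (@steps_point_step _ _ _ (Ordinal lti)) //.
have : (p.2 (Ordinal lti))%:R <= r%:R * 2 :> R.
  by rewrite -natrM muln2 ler_nat -ltnS.
have := ler0n R (p.2 (Ordinal lti)); lra.
Qed.

Lemma ehrhart_PiC (n r : nat) :
  ehrhart (PiC R n.+1) r = (r.+1 * r.*2.+1 ^ n)%N.
Proof.
rewrite /ehrhart dilate_PiC_half_lattice card_fset_set_range.
  by rewrite card_prod card_ffun !card_ord.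
exact: steps_point_inj.
Qed.

End EhrhartPiC.

(** * The two identities *)

(** The polytope has dimension n + 1, so its denominator (1 - t)^(n+2) is the case d = 2. *)
Lemma hstar_moments (R : realType) (n : nat) (h : nat -> {poly rat}) :
  moment_numerators 2 (fun r => r.+1%:R) (fun r => 2 * r%:R + 1) h ->
  hstar (PiC R n.+1) = h n.
Proof.
move=> hM; apply: hstarE; rewrite /is_hstar hM rmorphB rmorph1 /=.
congr (_ * _); apply/fpsP=> r /=; rewrite ehrhart_PiC natrM natrX.
by rewrite -muln2 -[(r * 2).+1%:R]natr1 natrM [r%:R * 2]mulrC.
Qed.

Theorem theoremE (R : realType) :
  egf (fun n => hstar (PiC R n.+1))
    = fps_exp (3 * ('X - 1)) * fps_dilate 2 EulA ^+ 2
  /\ (fps_const 'X - fps_exp ('X - 1)) * EulA = fps_const ('X - 1).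
Proof.
have natC k : k%:R = (k%:R : rat)%:P :> {poly rat} by rewrite rmorph_nat.
split.
  rewrite fps_exp_egf /EulA fps_dilate_egf expr2 !egfM !natC.
  have E2 : moment_numerators 1 (fun=> 1) (fun r => 2 * r%:R + 2)
      (fun n => 2%:P ^+ n * eulerianA n).
    have := moment_numerators_dilate 2 eulerianA_moments.
    by apply: eq_moment_numerators => // r; rewrite -natr1; ring.
  have M := moment_numerators_exp 3 (moment_numerators_mul E2 E2).
  congr egf; apply/funext=> n; apply: (@hstar_moments R n (fun m => _)).
  by apply: eq_moment_numerators M => // r; ring.
rewrite mulrBl fps_exp_egf /EulA egfM.
have := moment_numerators_exp 1 eulerianA_moments.
set g := (fun n => \sum_(i < n.+1) _) => gM.
(* Multiplication by t moves the node r + 1 to r, so both sides have the same terms except at r = 0.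
   There [g] has the extra 0^n, which is nonzero only for n = 0. *)
have gE n : g n = 'X * eulerianA n - ('X - 1) *+ (n == 0).
  apply: fps_of_poly_inj; rewrite gM [RHS]rmorphB rmorphM /= eulerianA_moments.
  rewrite mulrCA.
  have -> : fps_of_poly (('X - 1) *+ (n == 0)) =
     - (fps_of_poly (1 - 'X) ^+ (1 + n) * fps_of_poly (n == 0)%:R) :> fps rat.
    case: n => [|n]; rewrite /= ?rmorph0 ?mulr0 ?oppr0 ?mulr0n ?rmorph0 //.
    by rewrite mulr1n rmorph1 mulr1 expr1 -[RHS]rmorphN /= opprB.
  rewrite opprK -mulrDr; congr (_ * _); apply/fpsP=> -[|r].
    by rewrite coef_fpsD coef_fpsXM /= subrr add0r mul1r expr0n coefMn coef1.
  rewrite coef_fpsD coef_fpsXM /= coefMn coef1 mul0rn addr0 -natr1; congr (_ * _ ^+ _).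
  by rewrite addrK.
apply/fpsP=> n; rewrite coef_fpsD coef_fpsN coef_fpsCM /=.
(* The factor 1 is the constant c = 1 appearing in [g]. *)
under eq_bigr => i _ do rewrite -['X - 1]mul1r.
rewrite -[X in _ - _ *: X]/(g n) gE scalerBr -scalerAr opprB addrC subrK.
case: n => [|n]; rewrite ?mulr0n ?scaler0 coefC //.
by rewrite fact0 invr1 scale1r.
Qed.
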